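(* Let $\ell$ be an odd prime, let $\epsilon\in\mathbb{F}_\ell^\times$ be a non-square, and let $G=\mathrm{GL}_2(\mathbb{F}_\ell)$. The $\mathbb{Q}$-linear map $$\psi^+ : \mathbb{Q}\big[(\mathbb{P}^1(\mathbb{F}_\ell)\times\mathbb{P}^1(\mathbb{F}_\ell)-\Delta)/\sim\big]\longrightarrow \mathbb{Q}[\mathfrak{H}_\ell],\qquad \{a,b\}\longmapsto \sum_{x\in\gamma_{\{a,b\}}} x$$ is a surjective $\mathbb{Q}[G]$-module homomorphism.
   Context: $\mathbb{F}_\ell=\mathbb{Z}/\ell\mathbb{Z}$. For a set $S$, $\mathbb{Q}[S]$ is the free $\mathbb{Q}$-vector space on $S$; if $G$ acts on $S$ then $\mathbb{Q}[S]$ is a $\mathbb{Q}[G]$-module by linear extension. $\mathbb{P}^1(\mathbb{F}_\ell)\times\mathbb{P}^1(\mathbb{F}_\ell)-\Delta$ is the set of ordered pairs $(a,b)$ of distinct points of $\mathbb{P}^1(\mathbb{F}_\ell)$, and $(\mathbb{P}^1(\mathbb{F}_\ell)\times\mathbb{P}^1(\mathbb{F}_\ell)-\Delta)/\sim$, with $(a,b)\sim(b,a)$, is the set of unordered pairs $\{a,b\}$ of distinct points. $\mathfrak{C}_\ell=\{x+y\sqrt{\epsilon}: x\in\mathbb{F}_\ell,\ y\in\mathbb{F}_\ell^\times\}\subseteq\mathbb{F}_{\ell^2}$, and $\mathfrak{H}_\ell=\mathfrak{C}_\ell/\sim$, where $x+y\sqrt{\epsilon}\sim x-y\sqrt{\epsilon}$.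 $G$ acts on $\mathbb{P}^1(\mathbb{F}_\ell)$, on $\mathfrak{C}_\ell$ and on $\mathfrak{H}_\ell$ by fractional linear transformations $z\mapsto (pz+q)/(rz+u)$ for the matrix $\begin{pmatrix}p&q\\ r&u\end{pmatrix}$, and on pairs of points componentwise. The geodesic $\gamma_{\{a,b\}}\subseteq\mathfrak{H}_\ell$ is defined as follows. $\gamma_{\{0,\infty\}}$ is the image in $\mathfrak{H}_\ell$ of the set $\mathbb{F}_\ell^\times\sqrt{\epsilon}\subseteq\mathfrak{C}_\ell$. For a general unordered pair $\{a,b\}$ choose $g\in G$ with $\{a,b\}=\{g(0),g(\infty)\}$ and set $\gamma_{\{a,b\}}:=g(\gamma_{\{0,\infty\}})$; this does not depend on the choice of $g$. The sum in the claim is over the distinct elements of the set $\gamma_{\{a,b\}}$. *)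

(* Defs.v *)
From HB Require Import structures.
From mathcomp Require Import all_boot all_order all_fingroup all_algebra.
From mathcomp Require Import ring.

Set Implicit Arguments.
Unset Strict Implicit.
Unset Printing Implicit Defensive.

Import GRing.Theory.
Local Open Scope ring_scope.

Section FreeModule.

Definition freeQ (S : finType) : lmodType rat := {ffun S -> rat^o}.

Definition basisQ (S : finType) (x : S) : freeQ S :=
  [ffun y : S => (y == x)%:R : rat^o].

Definition linextQ (S : finType) (V : lmodType rat) (f : S -> V)
    (u : freeQ S) : V :=
  \sum_(x : S) (u : {ffun S -> rat^o}) x *: f x.

Lemma linextQ_basis (S : finType) (V : lmodType rat) (f : S -> V) x :
  linextQ f (basisQ x) = f x.
Proof.
rewrite /linextQ (bigD1 x) //= ffunE eqxx scale1r big1 ?addr0 // => y yx.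
by rewrite ffunE (negbTE yx) scale0r.
Qed.

(* The elements of the group algebra Q[G] are those of [freeQ gT]; [act] is
   meant to be a left action of gT, so MathComp's (right) actions do not fit. *)
Definition scaleQG (gT : finGroupType) (S : finType) (act : gT -> S -> S)
    (alpha : freeQ gT) (u : freeQ S) : freeQ S :=
  linextQ (fun g => linextQ (fun x => basisQ (act g x)) u) alpha.

Lemma scaleQG_basis (gT : finGroupType) (S : finType) (act : gT -> S -> S) g x :
  scaleQG act (basisQ g) (basisQ x) = basisQ (act g x).
Proof. by rewrite /scaleQG !linextQ_basis. Qed.

Definition QG_module_hom (gT : finGroupType) (S T : finType)
    (actS : gT -> S -> S) (actT : gT -> T -> T) (f : freeQ S -> freeQ T) :=
  (forall u v, f (u + v) = f u + f v) /\
  (forall alpha u, f (scaleQG actS alpha u) = scaleQG actT alpha (f u)).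

End FreeModule.

Lemma det_mx22 (R : comNzRingType) (A : 'M[R]_2) :
  \det A = A 0 0 * A 1 1 - A 0 1 * A 1 0.
Proof.
rewrite (expand_det_row _ 0) !big_ord_recl big_ord0 /cofactor !det_mx11 !mxE.
rewrite /= expr0 expr1 addr0 mul1r mulN1r mulrN.
by congr (_ * _ - _ * _); congr (A _ _); apply: val_inj.
Qed.

Section Homography.

Variable F : fieldType.

(* [None] is the point at infinity. *)
Definition homography (p q r u : F) (z : option F) : option F :=
  match z with
  | Some z => if r * z + u == 0 then None else Some ((p * z + q) / (r * z + u))
  | None => if r == 0 then None else Some (p / r)
  end.

Lemma homography1 z : homography 1 0 0 1 z = z.
Proof.
rewrite /homography; case: z => [z|]; last by rewrite eqxx.
by rewrite mul0r add0r oner_eq0 mul1r addr0 divr1.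
Qed.

Lemma homographyM p q r u p' q' r' u' z :
  p' * u' - q' * r' != 0 ->
  homography (p * p' + q * r') (p * q' + q * u')
             (r * p' + u * r') (r * q' + u * u') z =
  homography p q r u (homography p' q' r' u' z).
Proof.
have cancel (a b c d e : F) : e != 0 ->
    (a * e + b * 0) / (c * e + d * 0) = a / c.
  by move=> e0; rewrite !mulr0 !addr0 -mulf_div divff // mulr1.
have scale (a b c d n e : F) : e != 0 -> c * n + d * e != 0 ->
    (a * n + b * e) / (c * n + d * e) = (a * (n / e) + b) / (c * (n / e) + d).
  by move=> e0 d0; field; rewrite e0 d0.
rewrite /homography => dh; case: z => [z|].
  have -> : (r * p' + u * r') * z + (r * q' + u * u') =
            r * (p' * z + q') + u * (r' * z + u') by ring.
  have -> : (p * p' + q * r') * z + (p * q' + q * u') =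
            p * (p' * z + q') + q * (r' * z + u') by ring.
  have : (p' * z + q' != 0) || (r' * z + u' != 0).
    rewrite -negb_and; apply: contra dh => /andP[/eqP n0 /eqP d0].
    have -> : p' * u' - q' * r' = p' * (r' * z + u') - r' * (p' * z + q') by ring.
    by rewrite n0 d0 !mulr0 subrr.
  move: (p' * z + q') (r' * z + u') => n d nd.
  case: (eqVneq d 0) nd => [-> | d0 _]; last first.
    have e : r * (n / d) + u = (r * n + u * d) / d by field.
    rewrite e mulf_eq0 invr_eq0 (negbTE d0) orbF; case: eqVneq => // e0.
    by rewrite scale // e.
  rewrite orbF => n0; rewrite cancel // mulr0 addr0 mulf_eq0 (negbTE n0) orbF.
  by [].
have : (p' != 0) || (r' != 0).
  rewrite -negb_and; apply: contra dh => /andP[/eqP -> /eqP ->].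
  by rewrite mul0r mulr0 subrr.
case: (eqVneq r' 0) => [-> | d0 _]; last first.
  have e : r * (p' / r') + u = (r * p' + u * r') / r' by field.
  rewrite e mulf_eq0 invr_eq0 (negbTE d0) orbF; case: eqVneq => // e0.
  by rewrite scale // e.
rewrite orbF => n0; rewrite cancel // mulr0 addr0 mulf_eq0 (negbTE n0) orbF.
by [].
Qed.

End Homography.

Section ProjectiveLine.

Variable l : nat.
Implicit Types (g h : {'GL_2[ 'F_l ]}).

Definition entry g (i j : 'I_2) : 'F_l := (GLval g : 'M['F_l]_2) i j.

Lemma entry1 i j : entry 1%g i j = (i == j)%:R.
Proof. by rewrite /entry GL_1E mxE. Qed.

Lemma entryM g h i j :
  entry (g * h)%g i j = entry g i 0 * entry h 0 j + entry g i 1 * entry h 1 j.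
Proof.
rewrite /entry GL_ME mxE big_ord_recl big_ord1.
by congr (_ * _ + _ * _); congr (GLval _ _ _); apply: val_inj.
Qed.

Lemma entry_det g :
  entry g 0 0 * entry g 1 1 - entry g 0 1 * entry g 1 0 != 0.
Proof.
have := GL_unit g; rewrite -[_ \is a _]/(GLval g \in unitmx) unitmxE unitfE.
by rewrite det_mx22.
Qed.

Definition P1 : finType := option 'F_l.

Definition P1_act g : P1 -> P1 :=
  homography (entry g 0 0) (entry g 0 1) (entry g 1 0) (entry g 1 1).

Lemma P1_act1 z : P1_act 1%g z = z.
Proof. by rewrite /P1_act !entry1 homography1. Qed.

Lemma P1_actM g h z : P1_act (g * h)%g z = P1_act g (P1_act h z).
Proof. by rewrite /P1_act !entryM homographyM // entry_det. Qed.

Lemma P1_act_inj g : injective (P1_act g).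
Proof.
apply: (can_inj (g := P1_act g^-1%g)) => z.
by rewrite -P1_actM mulVg P1_act1.
Qed.

Definition P1_pairs : finType := {A : {set P1} | #|A| == 2}.

Lemma P1_pairs_act_subproof g (A : P1_pairs) : #|P1_act g @: val A| == 2.
Proof. by rewrite card_imset ?(valP A) //; apply: P1_act_inj. Qed.

Definition P1_pairs_act g (A : P1_pairs) : P1_pairs :=
  Sub (P1_act g @: val A) (P1_pairs_act_subproof g A).

Lemma P1_pairs_transitive (A : P1_pairs) :
  exists g, val A == [set P1_act g (Some 0); P1_act g None].
Proof.
have mk (p q r u : 'F_l) : p * u - q * r != 0 ->
    exists g, [/\ entry g 0 0 = p, entry g 0 1 = q,
                  entry g 1 0 = r & entry g 1 1 = u].
  move=> d.
  pose M : 'M['F_l]_2 :=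
    \matrix_(i, j) if i == 0 then (if j == 0 then p else q)
                   else (if j == 0 then r else u).
  have uM : M \is a GRing.unit.
    by rewrite -[_ \is a _]/(M \in unitmx) unitmxE unitfE det_mx22 !mxE.
  by exists (Sub M uM); split; rewrite /entry /GLval /= ?mxE.
case: A => A /= /cards2P[a [b [ab ->]]].
case: a b ab => [a|] [b|] // ab.
- have [] := mk b a 1 1; first by rewrite !mulr1 subr_eq0 eq_sym.
  move=> g [e1 e2 e3 e4]; exists g; rewrite /P1_act /homography e1 e2 e3 e4.
  by rewrite !mulr0 !add0r oner_eq0 !divr1.
- have [] := mk 1 a 0 1; first by rewrite mulr1 mulr0 subr0 oner_eq0.
  move=> g [e1 e2 e3 e4]; exists g; rewrite /P1_act /homography e1 e2 e3 e4 eqxx.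
  by rewrite !mulr0 !add0r oner_eq0 !divr1.
- have [] := mk b 1 1 0; first by rewrite mulr0 mulr1 sub0r oppr_eq0 oner_eq0.
  move=> g [e1 e2 e3 e4]; exists g; rewrite /P1_act /homography e1 e2 e3 e4.
  by rewrite !mulr0 !add0r eqxx oner_eq0 !divr1.
Qed.

End ProjectiveLine.

Section HalfPlane.

Variables (l : nat) (eps : 'F_l).
(* K is to be the field with l^2 elements, and sqe a square root of eps in K. *)
Variables (K : finFieldType) (iota : {rmorphism 'F_l -> K}) (sqe : K).
Hypothesis eps_nonsquare : ~ (exists x : 'F_l, x ^+ 2 = eps).
Hypothesis sqeE : sqe ^+ 2 = iota eps.
Implicit Types (g h : {'GL_2[ 'F_l ]}) (x y : 'F_l).

Definition point (x y : 'F_l) : K := iota x + iota y * sqe.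

Definition Cset : {set K} := [set point xy.1 xy.2 | xy : 'F_l * 'F_l & xy.2 != 0].

(* The first disjunct makes the identification x + y sqe ~ x - y sqe reflexive. *)
Definition Crel (z w : K) : bool :=
  (z == w) || [exists x, exists y, (z == point x y) && (w == point x (- y))].

Definition Hset : {set {set K}} := equivalence_partition Crel Cset.

Definition H : finType := {A : {set K} | A \in Hset}.

Definition C_act g (z : K) : K :=
  (iota (entry g 0 0) * z + iota (entry g 0 1)) /
  (iota (entry g 1 0) * z + iota (entry g 1 1)).

Lemma point_inj x y x' y' : point x y = point x' y' -> x = x' /\ y = y'.
Proof using eps_nonsquare sqeE.
rewrite /point => e.
have e' : iota (y - y') * sqe = iota (x' - x).
  rewrite !rmorphB mulrBl; apply/eqP; rewrite subr_eq addrAC -e.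
  by rewrite [iota x + _]addrC addrK.
case: (eqVneq y y') => [yy | ny].
  split=> //; move: e'; rewrite yy subrr rmorph0 mul0r => /esym/eqP.
  by rewrite fmorph_eq0 subr_eq0 => /eqP.
have yn : y - y' != 0 by rewrite subr_eq0.
case: eps_nonsquare; exists ((x' - x) / (y - y')); apply: (fmorph_inj iota).
rewrite -sqeE rmorphXn fmorph_div -e' mulrAC divff ?mul1r //.
by rewrite fmorph_eq0.
Qed.

Lemma point_eq0 x y : (point x y == 0) = (x == 0) && (y == 0).
Proof using eps_nonsquare sqeE.
apply/eqP/andP=> [e | [/eqP-> /eqP->]].
  have [-> ->] : x = 0 /\ y = 0; last by [].
  by apply: point_inj; rewrite e /point !rmorph0 mul0r addr0.
by rewrite /point !rmorph0 mul0r addr0.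
Qed.

Lemma CsetP z :
  reflect (exists x y, y != 0 /\ z = point x y) (z \in Cset).
Proof using Type.
apply: (iffP imsetP) => [[[x y]] /= | [x [y [y0 ->]]]].
  by rewrite inE => y0 ->; exists x, y.
by exists (x, y); rewrite ?inE.
Qed.

Definition C_norm g (x y : 'F_l) : 'F_l :=
  (entry g 1 0 * x + entry g 1 1) ^+ 2 - eps * (entry g 1 0 * y) ^+ 2.

Lemma C_den g x y :
  iota (entry g 1 0) * point x y + iota (entry g 1 1) =
  point (entry g 1 0 * x + entry g 1 1) (entry g 1 0 * y).
Proof using Type. by rewrite /point rmorphD !rmorphM; ring. Qed.

Lemma C_den_neq0 g x y : y != 0 ->
  iota (entry g 1 0) * point x y + iota (entry g 1 1) != 0.
Proof using eps_nonsquare sqeE.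
move=> y0; rewrite C_den point_eq0 mulf_eq0 (negbTE y0) orbF andbC.
apply/negP=> /andP[/eqP r0]; rewrite r0 mul0r add0r => /eqP u0.
by have := entry_det g; rewrite r0 u0 !mulr0 subrr eqxx.
Qed.

Lemma C_norm_neq0 g x y : y != 0 -> C_norm g x y != 0.
Proof using eps_nonsquare sqeE.
move=> y0; have := C_den_neq0 g x y0.
have := @C_den_neq0 g x (- y); rewrite oppr_eq0 => /(_ y0) n1 n2.
have : iota (C_norm g x y) != 0; last by rewrite fmorph_eq0.
have -> : iota (C_norm g x y) =
  (iota (entry g 1 0) * point x y + iota (entry g 1 1)) *
  (iota (entry g 1 0) * point x (- y) + iota (entry g 1 1)).
  by rewrite /C_norm !C_den /point rmorphB [iota (eps * _)]rmorphM -sqeE; ring.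
by rewrite mulf_neq0.
Qed.

Lemma C_act_point g x y : y != 0 ->
  C_act g (point x y) =
  point (((entry g 0 0 * x + entry g 0 1) * (entry g 1 0 * x + entry g 1 1)
           - eps * entry g 0 0 * entry g 1 0 * y ^+ 2) / C_norm g x y)
        ((entry g 0 0 * entry g 1 1 - entry g 0 1 * entry g 1 0) * y
           / C_norm g x y).
Proof using eps_nonsquare sqeE.
move=> y0; have n0 := C_norm_neq0 g x y0; have d0 := C_den_neq0 g x y0.
apply: (mulIf d0); rewrite divfK // C_den /point !fmorph_div.
have : iota (C_norm g x y) != 0 by rewrite fmorph_eq0.
rewrite /C_norm !(rmorphB, rmorphD, rmorphM, rmorphXn) /= -sqeE => m0.
by field.
Qed.

Lemma C_act_stable g z : z \in Cset -> C_act g z \in Cset.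
Proof using eps_nonsquare sqeE.
case/CsetP=> x [y [y0 ->]]; rewrite C_act_point //; apply/CsetP.
do 2!eexists; split; last by [].
by rewrite !mulf_neq0 ?entry_det ?invr_eq0 ?C_norm_neq0.
Qed.

Lemma C_act1 z : C_act 1%g z = z.
Proof using Type.
by rewrite /C_act !entry1 /= !rmorph0 !rmorph1 mul0r mul1r addr0 add0r divr1.
Qed.

Lemma C_actM g h z : z \in Cset -> C_act (g * h)%g z = C_act g (C_act h z).
Proof using eps_nonsquare sqeE.
move=> Cz; have hz := C_act_stable h Cz.
case/CsetP: (hz) => x1 [y1 [y10 e1]]; have := C_den_neq0 g x1 y10; rewrite -e1.
case/CsetP: (Cz) => x [y [y0 ez]]; have := C_den_neq0 h x y0.
have := C_den_neq0 (g * h)%g x y0; rewrite -ez {hz x1 y1 y10 e1 x y y0 ez}.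
rewrite /C_act !entryM !rmorphD !rmorphM => n1 n2 n3.
move: (iota (entry g 0 0)) (iota (entry g 0 1)) n1 n2 n3 => p q.
move: (iota (entry g 1 0)) (iota (entry g 1 1)) => r u.
move: (iota (entry h 0 0)) (iota (entry h 0 1)) => p' q'.
move: (iota (entry h 1 0)) (iota (entry h 1 1)) => r' u'.
have -> : (r * p' + u * r') * z + (r * q' + u * u') =
          r * (p' * z + q') + u * (r' * z + u') by ring.
have -> : (p * p' + q * r') * z + (p * q' + q * u') =
          p * (p' * z + q') + q * (r' * z + u') by ring.
move: (p' * z + q') (r' * z + u') => n d n1 n2 _.
by field; rewrite n1 n2.
Qed.

Lemma Crel_act g z w : z \in Cset -> Crel z w -> Crel (C_act g z) (C_act g w).
Proof using eps_nonsquare sqeE.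
move=> Cz /orP[/eqP-> | ]; first by rewrite /Crel eqxx.
case/existsP=> x /existsP[y /andP[/eqP ez /eqP ew]].
have y0 : y != 0.
  by case/CsetP: Cz => x' [y' [y0' e]]; move: e; rewrite ez => /point_inj[_ ->].
apply/orP; right; rewrite ez ew !C_act_point ?oppr_eq0 //.
have -> : C_norm g x (- y) = C_norm g x y by rewrite /C_norm mulrN sqrrN.
rewrite sqrrN !(mulrN, mulNr).
by apply/existsP; eexists; apply/existsP; eexists; apply/andP; split; apply/eqP.
Qed.

Lemma H_act_subproof g (A : H) : C_act g @: val A \in Hset.
Proof using eps_nonsquare sqeE.
case: A => A /= /imsetP[z Cz ->]; apply/imsetP; exists (C_act g z).
  exact: C_act_stable.
apply/setP=> w; apply/imsetP/idP=> [[w' + ->] | ].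
  by rewrite !inE => /andP[Cw' r]; rewrite C_act_stable ?Crel_act.
rewrite inE => /andP[Cw r]; exists (C_act g^-1%g w); last first.
  by rewrite -C_actM // mulgV C_act1.
rewrite inE C_act_stable //=.
by rewrite -[X in Crel X _]C_act1 -(mulVg g) C_actM // Crel_act // C_act_stable.
Qed.

Definition H_act g (A : H) : H :=
  Sub (C_act g @: val A) (H_act_subproof g A).

Lemma H_act1 A : H_act 1%g A = A.
Proof using Type.
apply: val_inj; rewrite /= (eq_imset (g := id)) ?imset_id //.
exact: C_act1.
Qed.

Lemma H_actM g h A : H_act (g * h)%g A = H_act g (H_act h A).
Proof using Type.
apply: val_inj => /=; rewrite -imset_comp; apply: eq_in_imset => z.
case/imsetP: (valP A) => w _ ->; rewrite inE => /andP[Cz _].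
exact: C_actM.
Qed.

Definition Cclass (z : K) : {set K} := [set w in Cset | Crel z w].

Definition geodesic0 : {set H} :=
  [set A : H | [exists y : 'F_l, (y != 0) && (val A == Cclass (iota y * sqe))]].

(* [geodesicE] below shows that the choice of g is irrelevant. *)
Definition geodesic (P : P1_pairs l) : {set H} :=
  H_act (xchoose (P1_pairs_transitive P)) @: geodesic0.

Lemma geodesicE (P : P1_pairs l) g :
  val P = [set P1_act g (Some 0); P1_act g None] ->
  geodesic P = H_act g @: geodesic0.
Proof using Type.
have stab h : [set P1_act h (Some 0); P1_act h None] = [set Some 0; None] ->
    H_act h @: geodesic0 \subset geodesic0.
  move=> e; apply/subsetP=> _ /imsetP[A + ->]; rewrite !inE.
  case/existsP=> y /andP[y0 /eqP eA].
  have Cy : iota y * sqe \in Cset.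
    by apply/CsetP; exists 0, y; split=> //; rewrite /point rmorph0 add0r.
  have ey : iota y * sqe = point 0 y by rewrite /point rmorph0 add0r.
  have [y' y'0 ey'] : exists2 y', y' != 0 & C_act h (iota y * sqe) = iota y' * sqe.
    suff x0 : ((entry h 0 0 * 0 + entry h 0 1) * (entry h 1 0 * 0 + entry h 1 1)
           - eps * entry h 0 0 * entry h 1 0 * y ^+ 2) / C_norm h 0 y = 0.
      rewrite ey C_act_point // x0 /point rmorph0 add0r; eexists; last by [].
      by rewrite !mulf_neq0 ?entry_det ?invr_eq0 ?C_norm_neq0.
    have e1 : entry h 0 1 * entry h 1 1 = 0.
      have : P1_act h (Some 0) \in [set Some 0; None] by rewrite -e !inE eqxx.
      rewrite !inE /P1_act /homography !mulr0 !add0r.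
      case: (eqVneq (entry h 1 1) 0) => [-> _ | u0]; first by rewrite mulr0.
      case/orP=> // /eqP/Some_inj/eqP; rewrite mulf_eq0 invr_eq0 (negbTE u0) orbF.
      by move/eqP->; rewrite mul0r.
    have e2 : entry h 0 0 * entry h 1 0 = 0.
      have : P1_act h None \in [set Some 0; None] by rewrite -e !inE eqxx orbT.
      rewrite !inE /P1_act /homography.
      case: (eqVneq (entry h 1 0) 0) => [-> _ | r0]; first by rewrite mulr0.
      case/orP=> // /eqP/Some_inj/eqP; rewrite mulf_eq0 invr_eq0 (negbTE r0) orbF.
      by move/eqP->; rewrite mul0r.
    by rewrite !mulr0 !add0r e1 -[eps * _ * _]mulrA e2 mulr0 mul0r subrr mul0r.
  apply/existsP; exists y'; rewrite y'0 /= eA -ey'; apply/eqP/setP=> w.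
  apply/imsetP/idP=> [[w' + ->] | ].
    by rewrite !inE => /andP[Cw' r]; rewrite C_act_stable ?Crel_act.
  rewrite inE => /andP[Cw r]; exists (C_act h^-1%g w); last first.
    by rewrite -C_actM // mulgV C_act1.
  rewrite inE C_act_stable //=.
  by rewrite -[X in Crel X _]C_act1 -(mulVg h) C_actM // Crel_act // C_act_stable.
have sub k h : [set P1_act h (Some 0); P1_act h None] =
      [set P1_act k (Some 0); P1_act k None] ->
    H_act h @: geodesic0 \subset H_act k @: geodesic0.
  move=> e; have /stab/(imsetS (H_act k)) :
      [set P1_act (k^-1 * h)%g (Some 0); P1_act (k^-1 * h)%g None] =
      [set Some 0; None].
    have img h' a b : [set P1_act (k^-1 * h')%g a; P1_act (k^-1 * h')%g b] =
                      P1_act k^-1%g @: [set P1_act h' a; P1_act h' b].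
      by rewrite imsetU1 imset_set1 !P1_actM.
    by rewrite img e -img mulVg !P1_act1.
  apply: subset_trans; rewrite -imset_comp (@eq_imset _ _ (H_act h) (H_act k \o H_act (k^-1 * h)%g)) //.
  by move=> A /=; rewrite -H_actM mulKVg.
move=> eP; rewrite /geodesic; have /eqP := xchooseP (P1_pairs_transitive P).
move: (xchoose _) => k ek; have {}eP := etrans (esym eP) ek.
by apply/eqP; rewrite eqEsubset !sub.
Qed.

Definition psi_plus : freeQ (P1_pairs l) -> freeQ H :=
  linextQ (fun P => \sum_(A in geodesic P) basisQ A).

End HalfPlane.

(* Main.v *)
From HB Require Import structures.
Require Import Defs.
From mathcomp Require Import all_boot all_order all_fingroup all_algebra.
From mathcomp Require Import all_field ring zify.
Import GRing.Theory.
Local Open Scope ring_scope.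

(** Linearity is built into psi, and equivariance says that the geodesic of
    {ga, gb} is the g-translate of the geodesic of {a, b} ([geodesic_act]).
    The content is surjectivity.

    The matrix of psi is the incidence matrix of geodesics and points, and its
    entries are integers.  If its columns are linearly independent over some
    field, then a maximal minor is nonzero there, hence nonzero as an integer,
    and the rows span everything over the rationals ([int_rows_span_rat]).  The
    field to use is F_l itself.  It has to be shown that a function
    f : H -> F_l whose sum over every geodesic vanishes is zero
    ([geodesic_sums_inj]); the proof uses the geodesics with finite endpoints.

    A point of H is a pair x, +-y with y != 0, and it lies on the geodesic of
    {a, b} exactly when (x - a)(x - b) = eps y^2 ([geodesic_point]).  So f
    becomes a function F(x, y), even in y and zero at y = 0, whose sum over
    each of these conics vanishes.  The case a = b is harmless: as eps is not
    a square, that conic has no point with y != 0.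

    The decisive step ([hyperbola_sums_inj]) is to add up these relations with
    weights a^i (b - a)^(2k), where 2k < l - 1.  The pairs (a, b) whose conic
    contains (x, y) are a = x - u, b = x - eps y^2 / u with u != 0, so the
    relation obtained is
      sum_(x, y) F(x, y) sum_(u != 0) (x - u)^i (u - eps y^2 / u)^(2k) = 0.
    By induction on i, all moments of F in x of order less than i vanish, so
    (x - u)^i may be replaced by x^i.  The remaining sum over u retains only
    the constant term of the Laurent polynomial (u - eps y^2 / u)^(2k) and
    equals - C(2k, k) (- eps)^k y^(2k) ([sum_unit_hyperbola]).  Since l does
    not divide C(2k, k) ([central_bin_neq0]), the i-th moment in x, an even
    function of y vanishing at 0, has all its own moments zero and so is zero
    ([moments_eq0]).  A function F(., y) all of whose moments vanish is zero. *)

(** * Rational span from independence over another field *)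

(** Independence of the columns over F gives a maximal minor that is nonzero in
    F; a nonzero image in F forces the integer minor to be nonzero. *)
Lemma int_rows_span_rat (F : fieldType) (I J : finType) (a : I -> J -> int) :
  (forall f : J -> F,
     (forall i, \sum_j (a i j)%:~R * f j = 0) -> forall j, f j = 0) ->
  forall v : J -> rat, exists u : I -> rat,
    forall j, \sum_i u i * (a i j)%:~R = v j.
Proof.
move=> free v.
pose M : 'M[int]_(#|I|, #|J|) := \matrix_(i, j) a (enum_val i) (enum_val j).
have full : row_full (map_mx intr M : 'M[F]_(#|I|, #|J|)).
  rewrite -col_leq_rank -mxrank_tr row_leq_rank.
  apply: inj_row_free => w /(congr1 trmx); rewrite trmx_mul trmxK trmx0 => Mw.
  apply/rowP=> j; rewrite !mxE; rewrite -[j]enum_valK.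
  apply: (free (fun j => w 0 (enum_rank j))) => i.
  move/colP/(_ (enum_rank i)): Mw; rewrite !mxE => Mwi.
  rewrite -[RHS]Mwi (reindex _ (onW_bij _ (enum_val_bij J))) /=; apply: eq_bigr => k _.
  by rewrite !mxE enum_rankK enum_valK.
have := fullrowsub_unit full; rewrite -map_mxsub.
set N := mxsub _ _ _ => uN.
have {uN} detN : \det N != 0.
  by apply: contraTneq uN => e; rewrite unitmxE det_map_mx e rmorph0 unitr0.
have uN : map_mx intr N \in (unitmx : pred 'M[rat]_#|J|).
  by rewrite unitmxE det_map_mx unitfE intr_eq0.
have fullQ : row_full (map_mx intr M : 'M[rat]_(#|I|, #|J|)).
  rewrite -sub1mx; apply: (@submx_trans _ _ _ _ _ _ (map_mx intr N)).
    by rewrite sub1mx row_full_unit.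
  by rewrite map_mxsub; apply/rowsub_sub.
have /submxP[u uM] := submx_full (\row_j v (enum_val j)) fullQ.
exists (fun i => u 0 (enum_rank i)) => j.
move/rowP/(_ (enum_rank j)): uM; rewrite !mxE enum_rankK => ->.
rewrite (reindex _ (onW_bij _ (enum_val_bij I))) /=; apply: eq_bigr => k _.
by rewrite !mxE enum_valK enum_rankK.
Qed.

(** * Power sums over a finite field *)

Lemma expf_card_pred (F : finFieldType) (x : F) : x != 0 -> x ^+ #|F|.-1 = 1.
Proof.
move=> x0; apply: (mulfI x0); rewrite mulr1 -exprS prednK ?expf_card //.
by rewrite (leq_trans _ (finNzRing_gt1 F)).
Qed.

(** Multiplying the variable by a multiplies the sum by a^m, and some a != 0 has
    a^m != 1 because 'X^r - 1 has at most r roots, r the residue of m. *)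
Lemma sum_unit_expr_eq0 (F : finFieldType) (m : nat) :
  ~~ (#|F|.-1 %| m)%N -> \sum_(x : F | x != 0) x ^+ m = 0.
Proof.
move=> ndvd; set r := (m %% #|F|.-1)%N.
have q1 : (0 < #|F|.-1)%N by have := finNzRing_gt1 F; case: #|F| => [|[]].
have exprm (x : F) : x != 0 -> x ^+ m = x ^+ r.
  move=> x0; rewrite {1}(divn_eq m #|F|.-1) exprD mulnC exprM.
  by rewrite expf_card_pred // expr1n mul1r.
have [a a0 ar] : exists2 a : F, a != 0 & a ^+ r != 1.
  apply/exists_inP; apply: contraT => /exists_inPn all1.
  have r0 : (0 < r)%N by rewrite lt0n.
  have /(max_unity_roots r0) : all r.-unity_root (enum (predC1 (0 : F))).
    apply/allP=> x; rewrite mem_enum => x0.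
    by rewrite unity_rootE -[_ == 1]negbK all1.
  by rewrite enum_uniq -cardE cardC1 leqNgt ltn_mod q1 => /(_ isT).
have scale : \sum_(x : F | x != 0) x ^+ m = a ^+ m * \sum_(x : F | x != 0) x ^+ m.
  rewrite {1}(reindex_inj (mulfI a0)) mulr_sumr /=; apply: eq_big => x.
    by rewrite mulf_eq0 (negbTE a0).
  by rewrite exprMn.
apply/eqP; move/eqP: scale; rewrite -subr_eq0 -{1}[\sum_(_ | _) _]mul1r -mulrBl.
by rewrite mulf_eq0 exprm // subr_eq0 [1 == _]eq_sym (negbTE ar).
Qed.

(** Summation over the nonzero u keeps only the exponents divisible by q - 1, and
    2k < q - 1 leaves none but 0. *)
Lemma sum_unit_hyperbola (F : finFieldType) (k : nat) (n : F) :
  (k.*2 < #|F|.-1)%N ->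
  \sum_(u : F | u != 0) (u - n / u) ^+ k.*2 = - ((- n) ^+ k *+ 'C(k.*2, k)).
Proof.
move=> kq.
have expand (u : F) : u != 0 -> (u - n / u) ^+ k.*2 =
    \sum_(i < k.*2.+1)
       (- n) ^+ i * u ^+ ((k.*2 - i).*2 + (#|F|.-1 - k.*2)) *+ 'C(k.*2, i).
  move=> u0.
  (* u^(-2k) = u^(q - 1 - 2k) keeps all exponents nonnegative. *)
  have -> : u - n / u = (u ^+ 2 - n) * u^-1 by field.
  have -> : ((u ^+ 2 - n) * u^-1) ^+ k.*2 =
            (u ^+ 2 - n) ^+ k.*2 * u ^+ (#|F|.-1 - k.*2).
    by rewrite exprMn expfB // expf_card_pred // div1r exprVn.
  rewrite exprDn mulr_suml; apply: eq_bigr => i _.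
  by rewrite -exprM exprD mul2n mulrnAl; congr (_ *+ _); ring.
rewrite (eq_bigr _ expand) exchange_big /=.
have kk : (k < k.*2.+1)%N by lia.
rewrite (bigD1 (Ordinal kk)) //= [X in _ + X]big1 => [|i ik]; last first.
  rewrite sumrMnl -mulr_sumr sum_unit_expr_eq0 ?mulr0 ?mul0rn //.
  have {ik} : (i : nat) != k by apply: contra ik => /eqP e; apply/eqP/val_inj.
  have := ltn_ord i; move: (nat_of_ord i) (#|F|.-1) kq => {}i q kq ik ne.
  apply/negP=> /dvdnP[c]; case: c => [|[|c]]; nia.
have -> : ((k.*2 - k).*2 + (#|F|.-1 - k.*2) = #|F|.-1)%N by lia.
rewrite addr0 sumrMnl -mulr_sumr.
rewrite (eq_bigr (fun=> 1)) => [|u u0]; last exact: expf_card_pred.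
have q0 : #|F|%:R = 0 :> F.
  apply: (@addrI _ (\sum_(x : F) x)).
  rewrite addr0 [in RHS](@reindex_inj _ _ _ _ (+%R^~ 1)) /=; last exact: addIr.
  by rewrite big_split /= sumr_const cardT -cardE.
suff -> : \sum_(u : F | u != 0) 1 = -1 :> F by rewrite mulrN1 mulNrn.
rewrite sumr_const cardC1; apply/eqP.
rewrite -subr_eq0 opprK natr1 prednK ?q0 //.
by rewrite (leq_trans _ (finNzRing_gt1 F)).
Qed.

(** The polynomial 1 - ('X - a)^(q - 1) is the indicator function of a, so g a is
    a combination of moments of g. *)
Lemma moments_eq0 (F : finFieldType) (g : F -> F) :
  (forall j, (j < #|F|)%N -> \sum_x x ^+ j * g x = 0) -> forall x, g x = 0.
Proof.
move=> mom a.
have q1 : (0 < #|F|.-1)%N by have := finNzRing_gt1 F; case: #|F| => [|[]].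
have : \sum_x (1 - (x - a) ^+ #|F|.-1) * g x = 0.
  under eq_bigr do rewrite mulrBl.
  rewrite sumrB; have := mom 0; rewrite (eq_bigr g) => [->|x _]; last by rewrite mul1r.
    rewrite sub0r; under eq_bigr do rewrite exprBn mulr_suml.
    rewrite exchange_big big1 ?oppr0 //= => i _.
    rewrite (eq_bigr (fun x => ((-1) ^+ i * a ^+ i *+ 'C(#|F|.-1, i)) *
                               (x ^+ (#|F|.-1 - i) * g x))) => [|x _].
      by rewrite -mulr_sumr mom ?mulr0 //; lia.
    by rewrite -!mulrnAr; ring.
  by lia.
rewrite (bigD1 a) //= subrr expr0n gtn_eqF // subr0 mul1r big1 ?addr0 // => x xa.
by rewrite expf_card_pred ?subr_eq0 // subrr mul0r.
Qed.

(** Given a point (x, y) with y != 0 and n = eps y^2, this runs over the pairs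
    (a, b) whose geodesic passes through it; the parameter is u = x - a. *)
Lemma sum_hyperbola_param (F : finFieldType) (w : F -> F -> F) (x n : F) :
  n != 0 ->
  \sum_a \sum_(b | (x - a) * (x - b) == n) w a b =
  \sum_(u | u != 0) w (x - u) (x - n / u).
Proof.
move=> n0; rewrite (reindex_inj (inv_inj (subKr x))) [RHS]big_mkcond /=.
apply: eq_bigr => u _; rewrite subKr; case: ifP => [u0 | /negbT].
  rewrite (big_pred1 (x - n / u)) // => b /=.
  by apply/eqP/eqP=> [<-|->]; field.
rewrite negbK => /eqP->; rewrite big1 // => b.
by rewrite mul0r eq_sym (negbTE n0).
Qed.

Lemma central_bin_neq0 (p k : nat) : prime p -> (k.*2 < p)%N ->
  ('C(k.*2, k))%:R != 0 :> 'F_p.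
Proof.
move=> pp kp; rewrite -(dvdn_pcharf (pchar_Fp pp)).
have : ~~ (p %| k.*2`!)%N.
  elim: k.*2 kp => [_|n IHn np]; first by rewrite dvdn1 neq_ltn prime_gt1 ?orbT.
  by rewrite factS Euclid_dvdM // negb_or IHn ?(ltnW np) // gtnNdvd.
by apply: contra => d; rewrite -(@bin_fact _ k) ?dvdn_mulr //; lia.
Qed.

(** * The conics (x - a)(x - b) = eps y^2 determine a function modulo l *)

(** The argument is a triangular one: among the moments in x, the weight
    a^i (b - a)^(2k) sees only the i-th once the smaller ones are zero, and
    varying k then yields the moments in y of that i-th moment. *)
Lemma hyperbola_sums_inj (l : nat) (eps : 'F_l) (F : 'F_l -> 'F_l -> 'F_l) :
  prime l -> odd l -> eps != 0 ->
  (forall x, F x 0 = 0) -> (forall x y, F x (- y) = F x y) ->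
  (forall a b, \sum_x \sum_(y | (x - a) * (x - b) == eps * y ^+ 2) F x y = 0) ->
  forall x y, F x y = 0.
Proof.
move=> pl ol eps0 F0 Fopp sumF.
have l2 : (2 < l)%N by move: ol (prime_gt1 pl); case: (l) => [|[|[]]].
have cardF : #|{: 'F_l}| = l by apply: card_Fp.
have weighted (w : 'F_l -> 'F_l -> 'F_l) :
    \sum_x \sum_y F x y * \sum_(u | u != 0) w (x - u) (x - eps * y ^+ 2 / u) = 0.
  transitivity (\sum_a \sum_b w a b *
      \sum_x \sum_(y | (x - a) * (x - b) == eps * y ^+ 2) F x y); last first.
    by do 2!(apply: big1 => ? _); rewrite sumF mulr0.
  transitivity (\sum_x \sum_y \sum_a \sum_(b | (x - a) * (x - b) == eps * y ^+ 2)
                  w a b * F x y).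
    apply: eq_bigr => x _; apply: eq_bigr => y _.
    have [-> | y0] := eqVneq y 0.
      by rewrite F0 mul0r; apply/esym; do 2!(apply: big1 => ? _); rewrite mulr0.
    rewrite -sum_hyperbola_param ?mulf_neq0 ?expf_neq0 // mulr_sumr.
    by apply: eq_bigr => a _; rewrite mulr_sumr; apply: eq_bigr => b _; rewrite mulrC.
  under eq_bigr do rewrite exchange_big.
  rewrite exchange_big; apply: eq_bigr => a _ /=.
  under eq_bigr => x _ do under eq_bigr => y _ do rewrite big_mkcond.
  under eq_bigr => x _ do rewrite exchange_big.
  rewrite exchange_big; apply: eq_bigr => b _ /=.
  rewrite mulr_sumr; apply: eq_bigr => x _; rewrite mulr_sumr [RHS]big_mkcond.
  by apply: eq_bigr.
suff xmom i y : \sum_x x ^+ i * F x y = 0.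
  by move=> x y; apply: (@moments_eq0 _ (F^~ y)) => j _; apply: xmom.
elim/ltn_ind: i y => i IHi; pose M y := \sum_x x ^+ i * F x y.
have even_moment k : (k.*2 < l.-1)%N -> \sum_y y ^+ k.*2 * M y = 0.
  move=> kl; have kq : (k.*2 < #|{: 'F_l}|.-1)%N by rewrite cardF.
  (* All terms of (x - u)^i but x^i involve smaller moments. *)
  have shift u y : \sum_x (x - u) ^+ i * F x y = M y.
    under eq_bigr do rewrite exprBn mulr_suml.
    rewrite exchange_big big_ord_recl /= [X in _ + X]big1 ?addr0 => [|j _].
      by apply: eq_bigr => x _; rewrite subn0 bin0; ring.
    rewrite (eq_bigr (fun x => ((-1) ^+ (lift ord0 j) * u ^+ (lift ord0 j)
               *+ 'C(i, lift ord0 j)) * (x ^+ (i - lift ord0 j) * F x y))) => [|x _].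
      by rewrite -mulr_sumr IHi ?mulr0 // lift0; have := ltn_ord j; lia.
    by rewrite -!mulrnAr; ring.
  have := weighted (fun a b => a ^+ i * (b - a) ^+ k.*2).
  rewrite exchange_big /= (eq_bigr (fun y =>
      - ((- eps) ^+ k *+ 'C(k.*2, k)) * (y ^+ k.*2 * M y))) => [|y _].
    rewrite -mulr_sumr => /eqP; rewrite mulf_eq0 oppr_eq0 -mulr_natr mulf_eq0.
    rewrite expf_eq0 oppr_eq0 (negbTE eps0) andbF /=.
    rewrite (negbTE (central_bin_neq0 _ _ pl _)) /=; last by lia.
    by move/eqP.
  transitivity (\sum_(u | u != 0) (u - eps * y ^+ 2 / u) ^+ k.*2 * M y).
    under [RHS]eq_bigr => u _ do rewrite -(shift u y) mulr_sumr.
    rewrite [RHS]exchange_big; apply: eq_bigr => x _ /=; rewrite mulr_sumr.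
    by apply: eq_bigr => u _; rewrite [x - _ - (x - u)]addrC opprB addrA subrK; ring.
  rewrite -mulr_suml sum_unit_hyperbola // -[- (eps * _)]mulNr exprMn -exprM mul2n.
  by rewrite !mulNr !mulrnAl mulrA.
move=> z; apply: (@moments_eq0 _ M) => j; rewrite cardF => jl.
(* Odd moments of an even function vanish by y |-> - y, as l is odd. *)
have [jeven | jodd] := boolP (~~ odd j); last first.
  set S := \sum_y _; have {}jodd : odd j by rewrite -[odd j]negbK.
  have SN : S = - S.
    rewrite /S {1}(reindex_inj oppr_inj) -sumrN; apply: eq_bigr => y _.
    rewrite /M exprNn -signr_odd jodd expr1 mulN1r mulNr; congr (- (_ * _)).
    by apply: eq_bigr => x _; rewrite Fopp.
  have : S *+ 2 == 0 by rewrite mulr2n {1}SN addNr.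
  rewrite -mulr_natr mulf_eq0 -(dvdn_pcharf (pchar_Fp pl)) gtnNdvd // orbF.
  by move/eqP.
(* For j = l - 1 the moment is the 0-th one, as y^(l - 1) = 1 unless y = 0. *)
have [jl1 | jl1] := ltnP j l.-1.
  by rewrite -[j]even_halfK // even_moment ?even_halfK.
have -> : j = l.-1 by lia.
rewrite -[RHS](even_moment 0%N) //; last by lia.
apply: eq_bigr => y _; have [-> | y0] := eqVneq y 0.
  by rewrite /M big1 ?mulr0 // => x _; rewrite F0 mulr0.
by have := expf_card_pred _ _ y0; rewrite cardF => ->.
Qed.

(** * Points and geodesics in coordinates *)

Lemma GL2_of_entries (l : nat) (p q r u : 'F_l) : p * u - q * r != 0 ->
  exists g : {'GL_2[ 'F_l ]},
    [/\ entry g 0 0 = p, entry g 0 1 = q, entry g 1 0 = r & entry g 1 1 = u].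
Proof.
move=> d.
pose M : 'M['F_l]_2 :=
  \matrix_(i, j) if i == 0 then (if j == 0 then p else q)
                 else (if j == 0 then r else u).
have uM : M \is a GRing.unit.
  by rewrite -[_ \is a _]/(M \in unitmx) unitmxE unitfE det_mx22 !mxE.
by exists (Sub M uM); split; rewrite /entry /GLval /= ?mxE.
Qed.

Section Geodesics.

Variables (l : nat) (eps : 'F_l) (K : finFieldType).
Variables (iota : {rmorphism 'F_l -> K}) (sqe : K).
Hypothesis eps_nonsquare : ~ (exists x : 'F_l, x ^+ 2 = eps).
Hypothesis sqeE : sqe ^+ 2 = iota eps.

Local Notation point := (point iota sqe).
Local Notation Cclass := (Cclass iota sqe).
Local Notation H := (H iota sqe).
Local Notation H_act := (H_act eps_nonsquare sqeE).
Local Notation geodesic := (geodesic eps_nonsquare sqeE).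

Lemma point_in_Cset x y : y != 0 -> point x y \in Cset iota sqe.
Proof. by move=> y0; apply/CsetP; exists x, y. Qed.

Lemma Cclass_pointE x y : y != 0 ->
  Cclass (point x y) = [set point x y; point x (- y)].
Proof using eps_nonsquare sqeE.
move=> y0; apply/setP=> w; rewrite !inE /Crel; apply/andP/orP=> [[_] | ].
  case/orP=> [/eqP-> | ]; first by left.
  case/existsP=> x' /existsP[y' /andP[/eqP e /eqP->]]; right.
  by have [-> ->] := point_inj eps_nonsquare sqeE e.
case=> /eqP->; first by rewrite eqxx point_in_Cset.
rewrite point_in_Cset ?oppr_eq0 //; split=> //; apply/orP; right.
by apply/existsP; exists x; apply/existsP; exists y; rewrite !eqxx.
Qed.

Lemma Cclass_point_eq x y x' y' : y != 0 -> y' != 0 ->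
  (Cclass (point x y) == Cclass (point x' y')) =
  (x == x') && ((y == y') || (y == - y')).
Proof using eps_nonsquare sqeE.
move=> y0 y'0; rewrite !Cclass_pointE //; apply/eqP/andP=> [e | [/eqP->]].
  have : point x y \in [set point x' y'; point x' (- y')] by rewrite -e !inE eqxx.
  by rewrite !inE => /orP[] /eqP /(point_inj eps_nonsquare sqeE)[-> ->];
    rewrite !eqxx ?orbT.
by case/orP=> /eqP->; rewrite ?opprK // setUC.
Qed.

Lemma H_point (A : H) : exists x y, y != 0 /\ val A = Cclass (point x y).
Proof using Type.
case/imsetP: (valP A) => z /CsetP[x [y [y0 ->]]] e.
by exists x, y; split.
Qed.

Lemma Cclass_in_Hset x y : y != 0 -> Cclass (point x y) \in Hset iota sqe.
Proof using Type. by move=> y0; apply: imset_f; apply: point_in_Cset. Qed.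

Lemma H_act_point g (A : H) x y : y != 0 -> val A = Cclass (point x y) ->
  val (H_act g A) = Cclass (C_act iota g (point x y)).
Proof using Type.
move=> y0 eA; rewrite /= eA Cclass_pointE // imsetU1 imset_set1.
rewrite !(C_act_point eps_nonsquare sqeE) ?oppr_eq0 //.
have -> : C_norm eps g x (- y) = C_norm eps g x y by rewrite /C_norm mulrN sqrrN.
rewrite sqrrN !(mulrN, mulNr) -Cclass_pointE //.
by rewrite !mulf_neq0 ?entry_det ?invr_eq0 ?(C_norm_neq0 eps_nonsquare sqeE).
Qed.

Lemma H_actK g : cancel (H_act g) (H_act g^-1%g).
Proof using Type. by move=> A; rewrite -H_actM mulVg H_act1. Qed.

Lemma H_actKV g : cancel (H_act g^-1%g) (H_act g).
Proof using Type. by move=> A; rewrite -H_actM mulgV H_act1. Qed.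

Lemma geodesic_act g (P : P1_pairs l) :
  geodesic (P1_pairs_act g P) = H_act g @: geodesic P.
Proof using Type.
have [k /eqP ek] := P1_pairs_transitive P.
rewrite (geodesicE eps_nonsquare sqeE ek) -imset_comp.
rewrite (@geodesicE _ _ _ _ _ eps_nonsquare sqeE _ (g * k)%g).
  by apply: eq_imset => A; rewrite /= H_actM.
by rewrite !P1_actM /= ek imsetU1 imset_set1.
Qed.

Lemma geodesic0_point (A : H) x y : y != 0 -> val A = Cclass (point x y) ->
  (A \in geodesic0 iota sqe) = (x == 0).
Proof using eps_nonsquare sqeE.
move=> y0 eA; rewrite inE eA.
have pt0 z : iota z * sqe = point 0 z by rewrite /Defs.point rmorph0 add0r.
apply/existsP/eqP=> [[z /andP[z0]] | ->].
  by rewrite pt0 Cclass_point_eq // => /andP[/eqP].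
by exists y; rewrite y0 pt0 eqxx.
Qed.

(** The matrix with rows (1, - a) and (- 1, b) moves a to 0 and b to infinity,
    hence the geodesic to the standard one, where the real part is 0.  The real
    part of the image of x + y sqe is (x - a)(b - x) + eps y^2, up to a nonzero
    factor. *)
Lemma geodesic_point (a b : 'F_l) (P : P1_pairs l) (A : H) x y :
  a != b -> val P = [set Some a; Some b] ->
  y != 0 -> val A = Cclass (point x y) ->
  (A \in geodesic P) = ((x - a) * (x - b) == eps * y ^+ 2).
Proof using Type.
move=> ab eP y0 eA; have ba : b - a != 0 by rewrite subr_eq0 eq_sym.
have [|h [h00 h01 h10 h11]] := @GL2_of_entries l 1 (- a) (- 1) b.
  by rewrite mul1r mulrN1 opprK.
have ha : P1_act h (Some a) = Some 0.
  rewrite /P1_act /homography h00 h01 h10 h11 mulN1r addrC (negbTE ba).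
  by rewrite mul1r subrr mul0r.
have hb : P1_act h (Some b) = None.
  by rewrite /P1_act /homography h00 h01 h10 h11 mulN1r addNr eqxx.
rewrite (@geodesicE _ _ _ _ _ eps_nonsquare sqeE _ h^-1%g); last first.
  by rewrite -ha -hb -!P1_actM mulVg !P1_act1.
rewrite -[A in LHS](H_actK h) mem_imset; last exact: (can_inj (H_actKV h)).
have hN0 : C_norm eps h x y != 0 by apply: (C_norm_neq0 eps_nonsquare sqeE).
have eA' := H_act_point h A x y y0 eA.
rewrite (C_act_point eps_nonsquare sqeE) // in eA'.
rewrite (geodesic0_point _ _ _ _ eA'); last first.
  by rewrite !mulf_neq0 ?entry_det ?invr_eq0.
rewrite mulf_eq0 invr_eq0 (negbTE hN0) orbF h00 h01 h10 h11.
by rewrite -[RHS]subr_eq0 -oppr_eq0; congr (_ == _); ring.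
Qed.

(** Pulled back to pairs (x, y), the sum of f over a geodesic is counted twice,
    once for each of the two signs of y; 2 is invertible modulo l. *)
Lemma geodesic_sums_inj (f : H -> 'F_l) : prime l -> odd l ->
  (forall P, \sum_(A in geodesic P) f A = 0) -> forall A, f A = 0.
Proof using Type.
move=> pl ol sumf.
have l2 : (2 < l)%N by move: ol (prime_gt1 pl); case: (l) => [|[|[]]].
have two0 : 2%:R != 0 :> 'F_l by rewrite -(dvdn_pcharf (pchar_Fp pl)) gtnNdvd.
have eps0 : eps != 0.
  by apply/eqP=> e; apply: eps_nonsquare; exists 0; rewrite e expr0n.
pose F x y := if y == 0 then 0 else oapp f 0 (insub (Cclass (point x y))).
have FE (A : H) x y : y != 0 -> val A = Cclass (point x y) -> F x y = f A.
  by move=> y0 eA; rewrite /F (negbTE y0) -eA valK.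
suff F_0 x y : F x y = 0.
  by move=> A; have [x [y [y0 eA]]] := H_point A; rewrite -(FE A x y).
apply: (@hyperbola_sums_inj l eps F pl ol eps0) => {x y} [x | x y | a b].
- by rewrite /F eqxx.
- rewrite /F oppr_eq0; have [//|y0] := eqVneq y 0.
  suff -> : Cclass (point x (- y)) = Cclass (point x y) by [].
  by apply/eqP; rewrite Cclass_point_eq ?oppr_eq0 // !eqxx orbT.
rewrite pair_big_dep /=.
have [<- | ab] := eqVneq a b.
  apply: big1 => -[x y] /= /eqP e; rewrite /F; have [//|y0] := eqVneq y 0.
  case: eps_nonsquare; exists ((x - a) / y).
  by rewrite expr_div_n expr2 e mulfK // expf_neq0.
have cP : #|[set Some a; Some b]| == 2 by rewrite cards2 (inj_eq Some_inj) ab.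
pose P : P1_pairs l := Sub [set Some a; Some b] cP.
rewrite (bigID (fun xy => xy.2 == 0)) /= big1 ?add0r => [|[x y] /andP[_]]; last first.
  by rewrite /F /= => ->.
(* A0 is a mere default value for insubd; it is never taken when y != 0. *)
have [A0 _ | H0] := pickP (@predT H); last first.
  apply: big1 => -[x y] /andP[_ y0].
  by have := H0 (Sub (Cclass (point x y)) (Cclass_in_Hset x y y0)).
pose cls (xy : 'F_l * 'F_l) : H := insubd A0 (Cclass (point xy.1 xy.2)).
have clsE x y : y != 0 -> val (cls (x, y)) = Cclass (point x y).
  by move=> y0; rewrite insubdK ?Cclass_in_Hset.
rewrite (partition_big cls (fun A => A \in geodesic P)) /= => [|[x y] /andP[xy y0]]; last first.
  by rewrite (geodesic_point a b P _ x y) ?clsE.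
rewrite -[RHS](mulr0 2%:R) -[in RHS](sumf P) mulr_sumr; apply: eq_bigr => A AP.
have [x [y [y0 eA]]] := H_point A.
transitivity (\sum_(xy in [set (x, y); (x, - y)]) f A).
  apply: eq_big => [[x' y'] | [x' y'] /andP[/andP[_ y'0] /eqP cA]] /=; last first.
    by apply: FE; rewrite // -cA clsE.
  rewrite !inE !xpair_eqE -andb_orr.
  apply/andP/idP=> [[/andP[_ y'0] /eqP cA] | xy].
    by rewrite -Cclass_point_eq // -clsE // cA eA.
  have y'0 : y' != 0 by case/andP: xy => _ /orP[] /eqP->; rewrite ?oppr_eq0.
  have cA : cls (x', y') = A.
    by apply: val_inj; rewrite clsE // eA; apply/eqP; rewrite Cclass_point_eq.
  by rewrite cA eqxx y'0 -(geodesic_point a b P A) ?AP // -cA clsE.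
rewrite sumr_const cards2 xpair_eqE eqxx /= mulr_natl.
suff -> : y != - y by [].
by rewrite -addr_eq0 -mulr2n -mulr_natr mulf_neq0.
Qed.

End Geodesics.

(** * Equivariance and surjectivity *)

Lemma linextQ_is_linear (S : finType) (V : lmodType rat) (f : S -> V) :
  linear (linextQ f).
Proof.
move=> c u v; rewrite /linextQ scaler_sumr -big_split; apply: eq_bigr => x _.
by rewrite !ffunE scalerDl scalerA.
Qed.

HB.instance Definition _ (S : finType) (V : lmodType rat) (f : S -> V) :=
  GRing.isLinear.Build rat (freeQ S) V _ (linextQ f) (linextQ_is_linear S V f).

Theorem theorem1
  (l : nat) (l_prime : prime l) (l_odd : odd l)
  (eps : 'F_l) (eps_neq0 : eps != 0)
  (eps_nonsquare : ~ (exists x : 'F_l, x ^+ 2 = eps))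
  (K : finFieldType) (cardK : #|K| = (l ^ 2)%N)
  (iota : {rmorphism 'F_l -> K})
  (sqe : K) (sqeE : sqe ^+ 2 = iota eps) :
  let psi := psi_plus eps_nonsquare sqeE in
  [/\ linear psi,
      QG_module_hom (@P1_pairs_act l) (H_act eps_nonsquare sqeE) psi
    & forall v, exists u, psi u = v].
Proof.
move=> psi; have psi_linear : linear psi by apply: linextQ_is_linear.
split=> //; first split=> [u v | alpha u].
- by have := psi_linear 1 u v; rewrite !scale1r.
- rewrite /psi /psi_plus /scaleQG [X in linextQ _ X = _]/linextQ [RHS]/linextQ.
  rewrite linear_sum; apply: eq_bigr => g _.
  rewrite linearZ; congr (_ *: _).
  rewrite [X in linextQ _ X = _]/linextQ [X in _ = linextQ _ X]/linextQ.
  rewrite !linear_sum; apply: eq_bigr => P _; rewrite !linearZ; congr (_ *: _).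
  rewrite [LHS]linextQ_basis geodesic_act big_imset /=; last first.
    by move=> A B _ _; apply: can_inj; apply: H_actK.
  by rewrite linear_sum; apply: eq_bigr => A _; rewrite [RHS]linextQ_basis.
- move=> v; pose gamma := geodesic eps_nonsquare sqeE.
  have [u uE] : exists u : P1_pairs l -> rat, forall B,
      \sum_P u P * ((B \in gamma P : nat)%:Z)%:~R = (v : {ffun _ -> rat}) B.
    apply: (@int_rows_span_rat 'F_l).
    move=> f fsum; apply: (@geodesic_sums_inj l eps) => // P.
    rewrite -[RHS](fsum P) big_mkcond; apply: eq_bigr => A _.
    by case: (A \in _); rewrite ?mul1r ?mul0r.
  exists ([ffun P => u P] : {ffun _ -> rat^o}).
  apply/ffunP=> B; rewrite -uE /psi /psi_plus /linextQ sum_ffunE.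
  apply: eq_bigr => P _; rewrite !ffunE sum_ffunE; congr (_ * _).
  under eq_bigr do rewrite ffunE.
  rewrite -/gamma; case: (boolP (B \in gamma P)) => BP.
    rewrite (bigD1 B) //= eqxx big1 ?addr0 // => A /andP[_ AB].
    by rewrite eq_sym (negbTE AB).
  rewrite big1 // => A AP; have [e | //] := eqVneq B A.
  by rewrite e AP in BP.
Qed.
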